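(* Let $n\ge3$, $\varphi\in S_n$, and let $x,y$ be two different points of $\mathfrak{M}_{(n,\varphi)}$. Then the number of blocks of $\mathfrak{M}_{(n,\varphi)}$ containing both $x$ and $y$ is $0$, $1$, $2$, or $n-2$.
   Context: Let $n\ge 3$, $I=\{1,\dots,n\}$, $\varphi\in S_n$ a permutation of $I$, and let $A=\{a_1,\dots,a_n\}$, $B=\{b_1,\dots,b_n\}$ be disjoint $n$-element sets. For $i\in I$ put $A_i=(A\setminus\{a_i\})\cup\{b_i\}$ and $B_i=(B\setminus\{b_i\})\cup\{a_{\varphi(i)}\}$. The Möbius $n$-pair $\mathfrak{M}_{(n,\varphi)}$ is the point-block structure with point set $A\cup B$ and block set $\{A_i: i\in I\}\cup\{B_i: i\in I\}$. *)

(* Defs.v *)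
From HB Require Import structures.
From mathcomp Require Import all_boot all_fingroup.

Set Implicit Arguments.
Unset Strict Implicit.
Unset Printing Implicit Defensive.

(* The index set {1, ..., n} is rendered as 'I_n. The families a and b list
   the elements of A and B inside an ambient finite type T; that they are
   injective with disjoint ranges is a hypothesis of the theorem. *)
Section MoebiusPair.

Variables (T : finType) (n : nat) (a b : 'I_n -> T) (phi : 'S_n).

Definition setA : {set T} := [set a i | i : 'I_n].
Definition setB : {set T} := [set b i | i : 'I_n].

Definition blockA (i : 'I_n) : {set T} := (setA :\ a i) :|: [set b i].
Definition blockB (i : 'I_n) : {set T} := (setB :\ b i) :|: [set a (phi i)].

Definition moebius_points : {set T} := setA :|: setB.

Definition moebius_blocks : {set {set T}} :=
  [set blockA i | i : 'I_n] :|: [set blockB i | i : 'I_n].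

Definition blocks_through (x y : T) : {set {set T}} :=
  [set X in moebius_blocks | (x \in X) && (y \in X)].

End MoebiusPair.

(* Main.v *)
(* Two points of A lie together exactly in the n - 2 blocks A_i avoiding both
   of their indices, and dually for two points of B.  A point a_j and a point
   b_k lie together at most in A_k and in B_i with phi i = j. *)
Require Import Defs.
From HB Require Import structures.
From mathcomp Require Import all_boot all_fingroup.

Section Incidence.

Variables (T : finType) (n : nat) (a b : 'I_n -> T) (phi : 'S_n).
Hypotheses (ha : injective a) (hb : injective b).
Hypothesis hab : [disjoint setA a & setB b].

Let a_neq_b j k : (a j == b k) = false.
Proof.
apply/eqP => e; have aA : a j \in setA a by apply: imset_f.
by move: (disjointFr hab aA); rewrite e imset_f.
Qed.

(** This and the next three lemmas form the incidence table: membership in a block becomes a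
    comparison of indices. *)
Lemma mem_a_blockA i j : (a j \in blockA a b i) = (j != i).
Proof.
by rewrite !inE a_neq_b orbF (inj_eq ha) imset_f // andbT.
Qed.

Lemma mem_b_blockA i k : (b k \in blockA a b i) = (k == i).
Proof.
rewrite !inE (inj_eq hb) eq_sym a_neq_b /=.
case: imsetP => [[j _ /esym/eqP]|_] //; by rewrite a_neq_b.
Qed.

Lemma mem_b_blockB i k : (b k \in blockB a b phi i) = (k != i).
Proof.
by rewrite !inE (inj_eq hb) imset_f // [b k == _]eq_sym a_neq_b orbF andbT.
Qed.

Lemma mem_a_blockB i j : (a j \in blockB a b phi i) = (j == phi i).
Proof.
rewrite !inE (inj_eq ha) a_neq_b /=.
by case: imsetP => [[k _ /eqP]|_] //; rewrite a_neq_b.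
Qed.

(** The only point of B on A_i is b_i, so the block determines its index. *)
Lemma blockA_inj : injective (blockA a b).
Proof.
by move=> i j e; apply/eqP; rewrite -mem_b_blockA -e mem_b_blockA.
Qed.

(** The only point of A on B_i is a_(phi i), so the block determines phi i, and hence i. *)
Lemma blockB_inj : injective (blockB a b phi).
Proof.
move=> i j e; apply: (@perm_inj _ phi); apply/eqP.
by rewrite -mem_a_blockB -e mem_a_blockB.
Qed.

(** No B_i can carry both points, since j = phi i = k would follow; and A_i misses a_i alone among
    the points of A. *)
Lemma blocks_through_aa j k : j != k ->
  blocks_through a b phi (a j) (a k) = [set blockA a b i | i in ~: [set j; k]].
Proof.
move=> jk; apply/setP => X; rewrite inE; apply/andP/imsetP.
  case=> /setUP[] /imsetP[i _ ->].
    rewrite !mem_a_blockA => /andP[ji ki].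
    by exists i; rewrite // !inE negb_or eq_sym ji eq_sym.
  by rewrite !mem_a_blockB => /andP[/eqP ji /eqP ki]; rewrite ji ki eqxx in jk.
case=> i; rewrite !inE negb_or => /andP[ij ik] ->.
by rewrite !mem_a_blockA eq_sym ij eq_sym ik imset_f.
Qed.

Lemma blocks_through_bb j k : j != k ->
  blocks_through a b phi (b j) (b k) =
    [set blockB a b phi i | i in ~: [set j; k]].
Proof.
move=> jk; apply/setP => X; rewrite inE; apply/andP/imsetP.
  case=> /setUP[] /imsetP[i _ ->].
    by rewrite !mem_b_blockA => /andP[/eqP ji /eqP ki]; rewrite ji ki eqxx in jk.
  rewrite !mem_b_blockB => /andP[ji ki].
  by exists i; rewrite // !inE negb_or eq_sym ji eq_sym.
case=> i; rewrite !inE negb_or => /andP[ij ik] ->.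
by rewrite !mem_b_blockB eq_sym ij eq_sym ik imset_f ?orbT.
Qed.

(** Only an inclusion holds: A_k misses a_j when j = k, and the B-block misses b_k when phi k = j.
    These coincidences are what allow the counts 0 and 1. *)
Lemma blocks_through_ab j k :
  blocks_through a b phi (a j) (b k) \subset
    [set blockA a b k; blockB a b phi ((phi^-1)%g j)].
Proof.
apply/subsetP => X; rewrite inE => /andP[/setUP[] /imsetP[i _ ->]].
  by rewrite mem_b_blockA => /andP[_ /eqP->]; rewrite set21.
by rewrite mem_a_blockB => /andP[/eqP-> _]; rewrite permK set22.
Qed.

Lemma card_blocks_through_ab j k :
  #|blocks_through a b phi (a j) (b k)| <= 2.
Proof.
apply: leq_trans (subset_leq_card (blocks_through_ab j k)) _.
by rewrite cards2; case: (_ != _).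
Qed.

End Incidence.

Lemma blocks_throughC (T : finType) (n : nat) (a b : 'I_n -> T) (phi : 'S_n)
    (x y : T) :
  blocks_through a b phi x y = blocks_through a b phi y x.
Proof. by apply/setP => X; rewrite !inE [(x \in X) && _]andbC. Qed.

(** The subtraction is never truncated, because two distinct indices force 2 <= n. *)
Lemma card_setC2 (n : nat) (j k : 'I_n) : j != k -> #|~: [set j; k]| = n - 2.
Proof. by move=> jk; rewrite cardsCs setCK cards2 jk card_ord. Qed.

Theorem proposition1p5 (T : finType) (n : nat) (hn : 3 <= n)
    (a b : 'I_n -> T) (phi : 'S_n)
    (ha : injective a) (hb : injective b)
    (hab : [disjoint setA a & setB b])
    (x y : T)
    (hx : x \in moebius_points a b) (hy : y \in moebius_points a b)
    (hxy : x <> y) :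
  let m := #|blocks_through a b phi x y| in
  [\/ m = 0, m = 1, m = 2 | m = n - 2].
Proof.
(* For a point of A and a point of B every value up to 2 is admissible, so the upper bound settles
   the case. *)
have le2 m : m <= 2 -> [\/ m = 0, m = 1, m = 2 | m = n - 2].
  by case: m => [|[|[|]]] // _; [apply: Or41 | apply: Or42 | apply: Or43].
case/setUP: hx hxy => /imsetP[j _ ->]; case/setUP: hy => /imsetP[k _ ->] hjk /=.
- have jk : j != k by apply/eqP => e; rewrite e in hjk.
  (* Blocks are counted as sets; injectivity of the indexing turns this into a count of indices. *)
  apply: Or44; rewrite blocks_through_aa // card_imset ?card_setC2 //.
  exact: blockA_inj.
- exact/le2/card_blocks_through_ab.
- by rewrite blocks_throughC; apply/le2/card_blocks_through_ab.
have jk : j != k by apply/eqP => e; rewrite e in hjk.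
apply: Or44; rewrite blocks_through_bb // card_imset ?card_setC2 //.
exact: blockB_inj.
Qed.
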